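(* Let $R$ be a finite commutative Frobenius ring of characteristic $2$, and let $p$ be a prime with $p=4k+3$ for an integer $k$. For $i\in\{0,1,2\}$ let $a_i,b_i,c_i\in R$, let $Q_i=Q_p(a_i,b_i,c_i)$, and let $A_i$ be a $p\times p$ circulant matrix over $R$. Let $\mathcal{C}$ be the linear code of length $6p$ over $R$ generated by the rows of $$M=\left(\begin{array}{ccc|ccc} Q_0&Q_1&Q_2&A_0&A_1&A_2\\ Q_2&Q_0&Q_1&A_2&A_0&A_1\\ Q_1&Q_2&Q_0&A_1&A_2&A_0\end{array}\right).$$ Then $\mathcal{C}$ is self-orthogonal if and only if the following two conditions hold: (1) $$\sum_{i=0}^2 A_iA_i^T=Q_p(\alpha',\beta',\beta'),\quad \alpha'=\sum_{i=0}^2(a_i^2+b_i^2+c_i^2),\quad \beta'=\sum_{i=0}^2\bigl(a_ib_i+a_ic_i+b_ic_i+k(b_i^2+c_i^2)\bigr);$$ (2) $$\sum_{i=0}^{2}A_iA_{[i+2]_3}^T=Q_p(\alpha,\beta,\gamma),$$ where $$\alpha=\sum_{i=0}^2\bigl(a_ia_{[i+2]_3}+b_ib_{[i+2]_3}+c_ic_{[i+2]_3}\bigr),$$ $$\beta=\sum_{i=0}^2\bigl[(a_ic_{[i+2]_3}+b_ia_{[i+2]_3})+kb_ib_{[i+2]_3}+kc_ic_{[i+2]_3}+kb_ic_{[i+2]_3}+(k+1)c_ib_{[i+2]_3}\bigr],$$ $$\gamma=\sum_{i=0}^2\bigl[(a_ib_{[i+2]_3}+c_ia_{[i+2]_3}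)+kb_ib_{[i+2]_3}+kc_ic_{[i+2]_3}+(k+1)b_ic_{[i+2]_3}+kc_ib_{[i+2]_3}\bigr].$$
   Context: For $a,b,c\in R$ and a prime $p$, $Q_p(a,b,c)$ is the $p\times p$ circulant matrix (each row is the right cyclic shift by one position of the row above it) whose first row $(r_0,r_1,\dots,r_{p-1})$ is given by $r_0=a$; $r_i=b$ if $i\neq 0$ is a quadratic residue modulo $p$; $r_i=c$ if $i$ is a quadratic non-residue modulo $p$. The notation $[m]_3$ denotes the residue of $m$ modulo $3$ in $\{0,1,2\}$. A code of length $n$ over $R$ is an $R$-submodule of $R^n$; its dual is $\mathcal{C}^\perp=\{x\in R^n : \sum_i x_iy_i=0 \text{ for all } y\in \mathcal{C}\}$ (Euclidean inner product). $\mathcal{C}$ is self-orthogonal if $\mathcal{C}\subseteq \mathcal{C}^\perp$. *)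

(* Defs.v *)
From HB Require Import structures.
From mathcomp Require Import all_boot all_order all_algebra.

Set Implicit Arguments.
Unset Strict Implicit.
Unset Printing Implicit Defensive.

Import GRing.Theory.
Local Open Scope ring_scope.
Local Open Scope quotient_scope.

Section Frobenius.
Variable R : finComNzRingType.
Implicit Types I J : {set R}.

Definition is_ideal I : bool :=
  [&& 0 \in I,
      [forall x in I, forall y in I, x + y \in I]
    & [forall r : R, forall x in I, r * x \in I]].

Definition maximal_ideal I : bool :=
  maxset (fun J : {set R} => is_ideal J && (J != setT)) I.

Definition minimal_ideal I : bool :=
  minset (fun J : {set R} => is_ideal J && (J != [set 0])) I.

Definition jacobson : {pred R} :=
  [pred x | [forall I : {set R}, maximal_ideal I ==> (x \in I)]].

(* The sum of all minimal ideals, i.e. of all simple R-submodules of R. *)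
Definition socle : {set R} :=
  [set x | [exists y : {ffun {set R} -> R},
    [forall I : {set R}, minimal_ideal I ==> (y I \in I)]
    && (x == \sum_(I : {set R} | minimal_ideal I) y I)]].

Fact jacobson_zmod_closed : zmod_closed jacobson.
Proof.
have idealP I : maximal_ideal I -> is_ideal I by move/maxsetp/andP=> [].
split=> [|x y /forallP Jx /forallP Jy]; apply/forallP=> I; apply/implyP=> mI;
  have /and3P[I0 ID IM] := idealP I mI; first exact: I0.
have Ix := implyP (Jx I) mI; have Iy := implyP (Jy I) mI.
have INy : - y \in I by rewrite -mulN1r; apply: (forall_inP (forallP IM (-1))).
exact: (forall_inP (forall_inP ID x Ix) (- y) INy).
Qed.

HB.instance Definition _ :=
  GRing.isZmodClosed.Build R jacobson jacobson_zmod_closed.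

(* R / J(R) and Soc(R) are isomorphic as R-modules.  The library only gives
   R / J(R) its additive structure; its R-module structure, r . [x] = [r * x],
   is spelled out. *)
Definition frobenius_ring : Prop :=
  exists f : {additive {ideal_quot jacobson} -> R},
    [/\ injective f,
        forall x : R, x \in socle <-> exists u, f u = x
      & forall r x : R, f (\pi_{ideal_quot jacobson} (r * x))
                        = r * f (\pi_{ideal_quot jacobson} x)].

End Frobenius.

Section Circulant.
Variable R : finComNzRingType.

(* Only the values of r below p matter; as i <= p, the index is j - i mod p. *)
Definition circulant p (r : nat -> R) : 'M[R]_p :=
  \matrix_(i, j) r ((j + (p - i)) %% p)%N.

Definition is_circulant p (A : 'M[R]_p) : Prop :=
  exists r : nat -> R, A = circulant p r.

Definition quad_residue (p i : nat) : bool :=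
  [exists x : 'I_p, (x ^ 2 == i %[mod p])%N].

Definition Qmx (p : nat) (a b c : R) : 'M[R]_p :=
  circulant p (fun i => if i == 0%N then a
                        else if quad_residue p i then b else c).

Definition block_circulant3 p (X : 'I_3 -> 'M[R]_p) : 'M[R]_(p + (p + p)) :=
  let X0 := X (inZp 0) in let X1 := X (inZp 1) in let X2 := X (inZp 2) in
  col_mx (row_mx X0 (row_mx X1 X2))
 (col_mx (row_mx X2 (row_mx X0 X1))
         (row_mx X1 (row_mx X2 X0))).

End Circulant.

Section Codes.
Variables (R : finComNzRingType) (n : nat).

(* The R-submodule of R^n generated by the rows of M: all their R-linear
   combinations. *)
Definition row_code m (M : 'M[R]_(m, n)) : {set 'rV[R]_n} :=
  [set \sum_(i < m) x 0 i *: row i M | x : 'rV[R]_m].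

Definition dual_code (C : {set 'rV[R]_n}) : {set 'rV[R]_n} :=
  [set x : 'rV[R]_n | [forall y in C, \sum_(i < n) x 0 i * y 0 i == 0]].

Definition self_orthogonal (C : {set 'rV[R]_n}) : bool :=
  C \subset dual_code C.

End Codes.

(* [m]_3, the residue of m modulo 3. *)
Definition res3 (m : nat) : 'I_3 := inZp m.

(* Main.v *)
Require Import Defs.
From HB Require Import structures.
From mathcomp Require Import all_boot all_order all_algebra all_field.
From mathcomp Require Import ring zify.

Set Implicit Arguments.
Unset Strict Implicit.
Unset Printing Implicit Defensive.

Import GRing.Theory.
Local Open Scope ring_scope.

(** Write Q_p(a,b,c) = a I + b S + c N, where S and N are the circulant 0/1
    matrices of the nonzero squares and of the non-squares modulo p.  As
    p = 4k+3, -1 is not a square, so N is the transpose of S and everything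
    rests on two products.

    The nonzero squares form the Paley difference set ([card_nz_squares_shift]):
    a nonzero t is a difference of two nonzero squares in exactly k ways.  Hence
    S N = N S = (2k+1) I + k (S + N) ([mulSN], [mulNS]).  Multiplying
    I + S + N, the all-one matrix, by S then gives
    S S = k S + (k+1) N ([mulSS]), and N N by transposition.  By bilinearity,
    Q_p(a,b,c) Q_p(a',b',c')^T is again of the form Q_p ([mulQmx_tr]); in
    characteristic 2 its parameters become the summands of the parameters in
    the two conditions.

    On the coding side, the code is self-orthogonal iff M M^T = 0
    ([self_orthogonal_row_code]), and M M^T is the sum of the Gram matrices of
    the two block circulants.  Such a Gram matrix has only three distinct
    blocks ([block_circulant3_gram]): G0 = sum_i X_i X_i^T on the diagonal,
    G1 = sum_i X_i X_(i+2)^T and the transpose of G1 elsewhere.  So M M^T = 0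
    says that the G0 and the G1 of the two halves cancel, that is, coincide in
    characteristic 2.  *)

(** * The Paley difference set in a field with 4k+3 elements *)

Section Paley.
Variables (F : finFieldType) (k : nat).
Hypothesis cardF : #|F| = (4 * k + 3)%N.

Definition nz_squares : {set F} := [set x ^+ 2 | x in [set~ 0]].

Lemma nz_squaresP x :
  reflect (x != 0 /\ exists y, x = y ^+ 2) (x \in nz_squares).
Proof.
apply: (iffP imsetP) => [[y] | [x0 [y xE]]].
  by rewrite !inE => y0 ->; split; [rewrite expf_neq0 | exists y].
exists y => //; rewrite !inE; apply: contraNneq x0 => y0.
by rewrite xE y0 expr0n.
Qed.

Lemma nz_squares0 : (0 \in nz_squares) = false.
Proof. by apply/nz_squaresP=> -[/eqP]. Qed.

Lemma nz_squaresM u x : u \in nz_squares ->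
  (u * x \in nz_squares) = (x \in nz_squares).
Proof.
move=> /nz_squaresP[u0 [v uE]]; have v0 : v != 0.
  by apply: contraNneq u0 => v0; rewrite uE v0 expr0n.
apply/nz_squaresP/nz_squaresP => -[x0 [y xE]].
  split; first by move: x0; rewrite mulf_eq0 negb_or => /andP[].
  by exists (y / v); rewrite expr_div_n -xE uE [_ * x]mulrC mulfK // expf_neq0.
by split; [rewrite mulf_neq0 | exists (v * y); rewrite exprMn -uE -xE].
Qed.

Lemma expf_card_pred (x : F) : x != 0 -> x ^+ (4 * k + 2) = 1.
Proof.
move=> x0; apply: (mulfI x0); rewrite -exprS mulr1.
by rewrite -[RHS](expf_card x) cardF; congr (_ ^+ _); lia.
Qed.

(** Euler's criterion.  An explicit root exists because 2k+2 is even: if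
    x^(2k+1) = 1 then x = x^(2k+2) = (x^(k+1))^2. *)
Lemma nz_squares_euler x : x != 0 ->
  (x \in nz_squares) = (x ^+ (2 * k + 1) == 1).
Proof.
move=> x0; apply/idP/eqP => [/nz_squaresP[_ [y xE]] | xe].
  have y0 : y != 0 by apply: contraNneq x0 => y0; rewrite xE y0 expr0n.
  by rewrite xE -exprM -[RHS](expf_card_pred y0); congr (_ ^+ _); lia.
apply/nz_squaresP; split=> //; exists (x ^+ k.+1).
rewrite -exprM (_ : (k.+1 * 2 = (2 * k + 1) + 1)%N); last by lia.
by rewrite exprD xe mul1r.
Qed.

(** Translation by 1 permutes the field, so the cardinal of the field vanishes
    in it; as it is odd, 2 does not. *)
Lemma oppr1_neq1 : (-1 : F) != 1.
Proof.
apply/eqP=> m1; have two0 : 1 + 1 = 0 :> F by rewrite -{1}m1 addNr.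
have card0 : (#|F|)%:R = 0 :> F.
  have : \sum_(x : F) x = \sum_(x : F) (x + 1).
    by rewrite (reindex_inj (@addIr F 1)).
  rewrite big_split /= -[LHS]addr0 => /addrI/esym.
  by rewrite sumr_const => ->.
move: (oner_eq0 F); rewrite -card0 cardF.
rewrite (_ : (4 * k + 3 = (2 * k + 1).*2.+1)%N); last by lia.
by rewrite -addn1 natrD -muln2 natrM [2%:R]two0 mulr0 add0r eqxx.
Qed.

(** By Euler's criterion, since (-x)^(2k+1) = - x^(2k+1) and x^(2k+1) is a square
    root of 1. *)
Lemma nz_squaresN x : x != 0 -> (- x \in nz_squares) = (x \notin nz_squares).
Proof.
move=> x0; rewrite !nz_squares_euler ?oppr_eq0 // exprNn.
rewrite -signr_odd (_ : odd (2 * k + 1) = true); last by lia.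
rewrite expr1 mulN1r.
have /eqP : (x ^+ (2 * k + 1)) ^+ 2 = 1.
  by rewrite -exprM -[RHS](expf_card_pred x0); congr (_ ^+ _); lia.
rewrite sqrf_eq1 => /orP[/eqP-> | /eqP->].
  by rewrite eqxx (negPf oppr1_neq1).
by rewrite opprK eqxx oppr1_neq1.
Qed.

(** The nonzero elements are the disjoint union of the nonzero squares and
    of their opposites. *)
Lemma card_nz_squares : #|nz_squares| = (2 * k + 1)%N.
Proof.
have : #|[set~ (0 : F)]| = (#|nz_squares| + #|nz_squares|)%N.
  rewrite -{2}(card_imset (mem nz_squares) (@oppr_inj F)) -cardsUI.
  set N := [set - x | x in _].
  have NE x : (x \in N) = (- x \in nz_squares).
    by rewrite -[in LHS](opprK x) mem_imset //; apply: oppr_inj.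
  rewrite [_ :&: _](_ : _ = set0) ?cards0 ?addn0; last first.
    apply/setP=> x; rewrite !inE NE; case: (eqVneq x 0) => [-> | x0].
      by rewrite nz_squares0.
    by rewrite nz_squaresN // andbN.
  apply: eq_card => x; rewrite !inE NE; case: (eqVneq x 0) => [-> | x0].
    by rewrite oppr0 nz_squares0.
  by rewrite nz_squaresN // orbN.
by rewrite cardsC1 cardF; lia.
Qed.

(** The number m t of representations of t as a difference of nonzero squares is
    invariant under multiplication of t by a square (scale both squares) and
    under t |-> -t (swap them), hence constant on t != 0.  Counting all pairs of
    squares gives (2k+1)^2 = (2k+1) + (4k+2) m, so m = k. *)
Lemma card_nz_squares_shift (t : F) : t != 0 ->
  #|[set y in nz_squares | y + t \in nz_squares]| = k.
Proof.
pose m (t : F) := #|[set y in nz_squares | y + t \in nz_squares]|.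
have mM (u x : F) : u \in nz_squares -> m (u * x) = m x.
  move=> uD; have [u0 _] := nz_squaresP _ uD.
  rewrite /m -(card_imset (mem [set y in _ | y + x \in _]) (mulfI u0)).
  apply: eq_card => y; have -> : y = u * (u^-1 * y) by rewrite mulVKf.
  rewrite mem_imset; last exact: mulfI.
  by rewrite !inE -(mulrDr u) !(nz_squaresM _ uD).
have mN x : m (- x) = m x.
  rewrite /m -(card_imset (mem [set y in _ | y + x \in _]) (addrI x)).
  apply: eq_card => y; have -> : y = x + (y - x) by rewrite addrC subrK.
  rewrite mem_imset; last exact: addrI.
  by rewrite !inE subrK [x + _]addrC subrK andbC.
have m1 (x : F) : x != 0 -> m x = m 1.
  move=> x0; have [xD | xD] := boolP (x \in nz_squares).
    by rewrite -[x]mulr1 mM.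
  by rewrite -mN -[- x]mulr1 mM // nz_squaresN.
have sum_m : \sum_x m x = (#|nz_squares| ^ 2)%N.
  rewrite (eq_bigr
    (fun x => \sum_(y in nz_squares) nat_of_bool (y + x \in nz_squares))).
    rewrite exchange_big /= -mulnn -sum_nat_const; apply: eq_bigr => y _.
    rewrite (reindex_inj (addrI (- y))) /= -sum1_card [RHS]big_mkcond.
    by apply: eq_bigr => x _; rewrite addNKr; case: (x \in _).
  move=> x _; rewrite /m -sum1_card big_mkcond [RHS]big_mkcond /=.
  by apply: eq_bigr => y _; rewrite inE; case: (y \in _) => //=; case: (_ \in _).
move=> t0; move: sum_m; rewrite (bigD1 0) //= (eq_bigr (fun=> m 1)) //.
have -> : m 0 = #|nz_squares|.
  by apply: eq_card => y; rewrite !inE addr0 andbb.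
rewrite (eq_bigl (mem [set~ 0])) => [|x]; last by rewrite !inE.
rewrite sum_nat_const cardsC1 cardF card_nz_squares -(m1 t) // /m.
by set n := #|_|; nia.
Qed.

End Paley.

(** * Products of the matrices Q_p *)

Section QMatrix.
Variables (R : finComNzRingType) (p k : nat).
Hypotheses (p_prime : prime p) (pE : p = (4 * k + 3)%N).
Local Notation F := 'F_p.
Local Notation D := (nz_squares F).
Local Notation res i := ((nat_of_ord i)%:R : F).

Lemma ord_Fp_bij : bijective (fun i : 'I_p => res i).
Proof.
apply: inj_card_bij => [i j /(congr1 (@nat_of_ord _))|]; last first.
  by rewrite card_Fp // card_ord.
by rewrite !val_Fp_nat //= !modn_small // => ij; apply: ord_inj.
Qed.

Lemma sum_ord_Fp (V : nmodType) (f : F -> V) :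
  \sum_(j < p) f (res j) = \sum_x f x.
Proof. by rewrite [RHS](reindex _ (onW_bij _ ord_Fp_bij)). Qed.

(** The symbol of the circulant Q_p(a,b,c): its entry (i, j) is the value of
    this function at j - i in F_p. *)
Definition on_classes (V : Type) (a b c : V) (d : F) : V :=
  if d == 0 then a else if d \in D then b else c.

Lemma card_Fp43 : #|F| = (4 * k + 3)%N.
Proof. by rewrite card_Fp. Qed.

Lemma on_classesN V (a b c : V) d : on_classes a b c (- d) = on_classes a c b d.
Proof.
rewrite /on_classes oppr_eq0; case: eqVneq => // d0.
by rewrite (nz_squaresN card_Fp43) //; case: (d \in D).
Qed.

Lemma quad_residueE (d : F) : d != 0 -> quad_residue p d = (d \in D).
Proof.
move=> d0; have dlt : (d < p)%N by rewrite -[X in (_ < X)%N](Fp_cast p_prime) ltn_ord.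
apply/existsP/nz_squaresP => [[x /eqP xE] | [_ [y yE]]].
  split=> //; exists (res x); apply: ord_inj.
  by rewrite -natrX val_Fp_nat // xE modn_small.
have [g _ gK] := ord_Fp_bij; exists (g y).
by rewrite -!val_Fp_nat // natrX gK -yE natr_Zp.
Qed.

Lemma QmxE (a b c : R) i j : Qmx p a b c i j = on_classes a b c (res j - res i).
Proof.
have dE : res j - res i = (j + (p - i))%:R.
  by rewrite natrD natrB 1?ltnW // pchar_Fp_0 // sub0r.
have vE : ((j + (p - i)) %% p)%N = (res j - res i)%R :> nat.
  by rewrite dE val_Fp_nat.
rewrite mxE vE /on_classes; case: eqVneq => [d0 | d0]; case: eqVneq => [d0' | d0'] //.
- by case/eqP: d0'; apply: ord_inj.
- by rewrite d0' eqxx in d0.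
- by rewrite quad_residueE.
Qed.

Local Notation S := (Qmx p 0 1 0 : 'M[R]_p).
Local Notation N := (Qmx p 0 0 1 : 'M[R]_p).

Lemma subr_ord_eq0 (i j : 'I_p) : (res j - res i == 0) = (i == j).
Proof. by rewrite subr_eq0 (inj_eq (bij_inj ord_Fp_bij)) eq_sym. Qed.

Lemma QmxD (a b c : R) : Qmx p a b c = a%:M + b *: S + c *: N.
Proof.
apply/matrixP=> i j; rewrite [LHS]QmxE 4!mxE [X in _ = _ + X]mxE !QmxE /on_classes.
rewrite subr_ord_eq0.
case: eqVneq => _; last case: (_ \in D);
  by rewrite ?mulr0 ?mulr1 ?mulr1n ?mulr0n ?addr0 ?add0r.
Qed.

Lemma trQmx (a b c : R) : (Qmx p a b c)^T = Qmx p a c b.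
Proof. by apply/matrixP=> i j; rewrite mxE !QmxE -on_classesN opprB. Qed.

Lemma sum_nz_squares (V : nzRingType) :
  \sum_(y : F) on_classes 0 1 0 y = (2 * k + 1)%:R :> V.
Proof.
rewrite -(card_nz_squares card_Fp43) -sum1_card natr_sum [RHS]big_mkcond.
apply: eq_bigr => y _; rewrite /on_classes; case: eqVneq => [-> | _] //.
by rewrite nz_squares0.
Qed.

(** The difference-set property, read as the autocorrelation of the indicator
    function of the nonzero squares. *)
Lemma autocorrelation_nz_squares (V : nzRingType) (t : F) :
  \sum_y on_classes 0 1 0 y * on_classes 0 1 0 (y + t)
  = on_classes (2 * k + 1)%:R k%:R k%:R t :> V.
Proof.
have sE x : on_classes 0 1 0 x = (x \in D)%:R :> V.
  by rewrite /on_classes; case: eqVneq => [-> | _]; rewrite ?nz_squares0 //; case: ifP.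
rewrite {3}/on_classes if_same; case: eqVneq => [-> | t0].
  rewrite -sum_nz_squares; apply: eq_bigr => y _; rewrite addr0 !sE.
  by case: (_ \in D); rewrite ?mulr1 ?mulr0.
rewrite -[in RHS](card_nz_squares_shift card_Fp43 t0) -sum1_card natr_sum.
rewrite [RHS]big_mkcond /=; apply: eq_bigr => y _; rewrite !sE inE.
by do 2!case: (_ \in D); rewrite ?mulr1 ?mulr0.
Qed.

(** As N is the transpose of S, the entry (i, j) of S N counts the x for which
    x - i and x - j are both nonzero squares: an autocorrelation at i - j. *)
Lemma mulSN : S *m N = Qmx p (2 * k + 1)%:R k%:R k%:R.
Proof.
apply/matrixP=> i j; rewrite QmxE -on_classesN opprB -autocorrelation_nz_squares mxE.
under eq_bigr => x _ do rewrite !QmxE -(on_classesN 0 1 0) opprB.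
rewrite (sum_ord_Fp
  (fun x => on_classes 0 1 0 (x - res i) * on_classes 0 1 0 (x - res j))).
rewrite (reindex_inj (@addIr F (res i))); apply: eq_bigr => x _.
by rewrite addrK addrA.
Qed.

(** Here i - x and j - x must both be nonzero squares; the substitution
    x |-> i - x gives an autocorrelation at j - i. *)
Lemma mulNS : N *m S = Qmx p (2 * k + 1)%:R k%:R k%:R.
Proof.
apply/matrixP=> i j; rewrite QmxE -autocorrelation_nz_squares mxE.
under eq_bigr => x _ do rewrite !QmxE -(on_classesN 0 1 0) opprB.
rewrite (sum_ord_Fp
  (fun x => on_classes 0 1 0 (res i - x) * on_classes 0 1 0 (res j - x))).
rewrite (reindex_inj (subrI (res i))); apply: eq_bigr => x _.
by rewrite !opprB [_ + (x - _)]addrC subrK addrCA addrA.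
Qed.

Lemma mulS_allone : S *m Qmx p 1 1 1 = (2 * k + 1)%:R *: Qmx p 1 1 1.
Proof.
apply/matrixP=> i j; rewrite [LHS]mxE [RHS]mxE QmxE /on_classes !if_same mulr1.
under eq_bigr => x _ do rewrite !QmxE {2}/on_classes !if_same mulr1.
rewrite (sum_ord_Fp (fun x => on_classes 0 1 0 (x - res i))) -sum_nz_squares.
by rewrite (reindex_inj (@addIr F (res i))); apply: eq_bigr => x _; rewrite addrK.
Qed.

(** S S is what remains of S (I + S + N) = (2k+1) (I + S + N) once S and S N are
    subtracted. *)
Lemma mulSS : S *m S = Qmx p 0 k%:R (k + 1)%:R.
Proof.
have := mulS_allone; rewrite (QmxD 1 1 1) !scale1r !mulmxDr mulmx1 mulSN.
move/(congr1 (fun X => X - Qmx p (2 * k + 1)%:R k%:R k%:R - S)) => /=.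
rewrite addrK [S + _]addrC addrK => ->.
rewrite (QmxD 0 k%:R) (QmxD (2 * k + 1)%:R).
(* Generalizing S and N keeps their entries atomic for the ring normalization. *)
move: S N => X Y; apply/matrixP=> i j; rewrite !mxE.
by case: (i == j); rewrite ?mulr1n ?mulr0n; ring.
Qed.

Lemma mulNN : N *m N = Qmx p 0 (k + 1)%:R k%:R.
Proof.
have NE : N = S^T by rewrite trQmx.
by rewrite [X in X *m _]NE [X in _ *m X]NE -trmx_mul mulSS trQmx.
Qed.

Lemma mulQmx_tr (a b c a' b' c' : R) :
  Qmx p a b c *m (Qmx p a' b' c')^T =
  Qmx p (a * a' + (2 * k + 1)%:R * (b * b' + c * c'))
    (a * c' + b * a' + k%:R * b * b' + k%:R * c * c' + k%:R * b * c'
      + (k + 1)%:R * c * b')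
    (a * b' + c * a' + k%:R * b * b' + k%:R * c * c' + (k + 1)%:R * b * c'
      + k%:R * c * b').
Proof.
rewrite trQmx (QmxD a) (QmxD a') !mulmxDl !mulmxDr.
rewrite -!scalemxAl -!scalemxAr mulSS mulSN mulNS mulNN.
rewrite [RHS]QmxD (QmxD 0 k%:R) (QmxD 0 (k + 1)%:R) (QmxD (2 * k + 1)%:R).
rewrite -[a%:M]scalemx1 -[a'%:M]scalemx1 -!scalemxAl -!scalemxAr !mulmx1 !mul1mx.
move: S N => X Y; apply/matrixP=> i j; rewrite !mxE.
by case: (i == j); rewrite ?mulr1n ?mulr0n; ring.
Qed.

End QMatrix.

(** * Gram matrices and self-orthogonality *)

Section BlockCirculant.
Variables (R : finComNzRingType) (p : nat).

Lemma sum_ord3 (V : nmodType) (f : 'I_3 -> V) :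
  \sum_(i < 3) f i = f (inZp 0) + f (inZp 1) + f (inZp 2).
Proof.
rewrite !big_ord_recl big_ord0 addr0 addrA.
by congr (f _ + f _ + f _); apply: ord_inj.
Qed.

(** The shape of X X^T for a 3 x 3 block circulant X: a symmetric block
    circulant, hence determined by its first two blocks. *)
Definition block_gram (G0 G1 : 'M[R]_p) : 'M[R]_(p + (p + p)) :=
  col_mx (row_mx G0 (row_mx G1 G1^T))
 (col_mx (row_mx G1^T (row_mx G0 G1))
         (row_mx G1 (row_mx G1^T G0))).

Lemma block_circulant3_gram (X : 'I_3 -> 'M[R]_p) :
  block_circulant3 X *m (block_circulant3 X)^T =
  block_gram (\sum_(i < 3) X i *m (X i)^T)
    (\sum_(i < 3) X i *m (X (res3 (i + 2)))^T).
Proof.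
rewrite !sum_ord3 /block_gram /block_circulant3 /=.
have -> : res3 (@inZp 2 0 + 2) = inZp 2 by apply: ord_inj.
have -> : res3 (@inZp 2 1 + 2) = inZp 0 by apply: ord_inj.
have -> : res3 (@inZp 2 2 + 2) = inZp 1 by apply: ord_inj.
move: (X (inZp 0)) (X (inZp 1)) (X (inZp 2)) => X0 X1 X2.
rewrite !tr_col_mx !tr_row_mx !mul_col_mx !mul_mx_row !mul_row_col.
rewrite !raddfD /= !trmx_mul !trmxK.
by congr (col_mx (row_mx _ (row_mx _ _)) (col_mx (row_mx _ (row_mx _ _))
  (row_mx _ (row_mx _ _))));
  first [exact: addrA | exact: addrC | rewrite addrA addrC addrA].
Qed.

Lemma block_gramD (G0 G1 H0 H1 : 'M[R]_p) :
  block_gram G0 G1 + block_gram H0 H1 = block_gram (G0 + H0) (G1 + H1).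
Proof. by rewrite /block_gram !add_col_mx !add_row_mx !raddfD. Qed.

Lemma block_gram_eq0 (G0 G1 : 'M[R]_p) :
  block_gram G0 G1 = 0 <-> G0 = 0 /\ G1 = 0.
Proof.
split=> [/eqP | [-> ->]]; last first.
  by rewrite /block_gram trmx0 !row_mx0 !col_mx0.
rewrite /block_gram !col_mx_eq0 !row_mx_eq0.
by move/andP=> [/and3P[/eqP-> /eqP-> _] _].
Qed.

Lemma self_orthogonal_row_code m n (M : 'M[R]_(m, n)) :
  self_orthogonal (row_code M) <-> M *m M^T = 0.
Proof.
have dotE (x y : 'rV[R]_n) : \sum_i x 0 i * y 0 i = (x *m y^T) 0 0.
  by rewrite mxE; apply: eq_bigr => i _; rewrite mxE.
have rowC i : row i M \in row_code M.
  by apply/imsetP; exists (delta_mx 0 i); rewrite // -mulmx_sum_row -rowE.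
split=> [/subsetP so | MM0].
  apply/matrixP=> i j; rewrite [RHS]mxE.
  have := so _ (rowC i); rewrite inE => /forall_inP/(_ _ (rowC j))/eqP <-.
  by rewrite mxE; apply: eq_bigr => l _; rewrite !mxE.
apply/subsetP=> _ /imsetP[u _ ->]; rewrite inE.
apply/forall_inP=> _ /imsetP[v _ ->]; rewrite dotE -!mulmx_sum_row.
by rewrite trmx_mul mulmxA -(mulmxA u) MM0 mulmx0 mul0mx mxE.
Qed.

End BlockCirculant.

Lemma Qmx_sum (R : finComNzRingType) p n (f g h : 'I_n -> R) :
  \sum_(i < n) Qmx p (f i) (g i) (h i) =
  Qmx p (\sum_(i < n) f i) (\sum_(i < n) g i) (\sum_(i < n) h i).
Proof.
apply/matrixP=> i j; rewrite summxE mxE.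
under eq_bigr => l _ do rewrite mxE.
by case: eqP => // _; case: quad_residue.
Qed.

Lemma addmx_eq0_pchar2 (R : nzRingType) m n (X Y : 'M[R]_(m, n)) :
  2%N \in [pchar R] -> X + Y = 0 <-> Y = X.
Proof.
move=> R2; have NX : - X = X.
  by apply/matrixP=> i j; rewrite mxE oppr_pchar2.
split=> [/eqP | ->]; last by rewrite -{1}NX addNr.
by rewrite addrC addr_eq0 NX => /eqP.
Qed.

(** * The characterization *)

Theorem theorem4p2 (R : finComNzRingType) (p k : nat)
  (a b c : 'I_3 -> R) (A : 'I_3 -> 'M[R]_p) :
  frobenius_ring R ->
  2%N \in [pchar R] ->
  prime p ->
  p = (4 * k + 3)%N ->
  (forall i, is_circulant (A i)) ->
  let Q i := Qmx p (a i) (b i) (c i) in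
  let M := row_mx (block_circulant3 Q) (block_circulant3 A) in
  let alpha' := \sum_(i < 3) (a i ^+ 2 + b i ^+ 2 + c i ^+ 2) in
  let beta' := \sum_(i < 3)
    (a i * b i + a i * c i + b i * c i + k%:R * (b i ^+ 2 + c i ^+ 2)) in
  let alpha := \sum_(i < 3)
    (a i * a (res3 (i + 2)) + b i * b (res3 (i + 2))
     + c i * c (res3 (i + 2))) in
  let beta := \sum_(i < 3)
    ((a i * c (res3 (i + 2)) + b i * a (res3 (i + 2)))
     + k%:R * b i * b (res3 (i + 2)) + k%:R * c i * c (res3 (i + 2))
     + k%:R * b i * c (res3 (i + 2)) + (k + 1)%:R * c i * b (res3 (i + 2))) in
  let gamma := \sum_(i < 3)
    ((a i * b (res3 (i + 2)) + c i * a (res3 (i + 2)))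
     + k%:R * b i * b (res3 (i + 2)) + k%:R * c i * c (res3 (i + 2))
     + (k + 1)%:R * b i * c (res3 (i + 2)) + k%:R * c i * b (res3 (i + 2))) in
  self_orthogonal (row_code M) <->
    (\sum_(i < 3) A i *m (A i)^T = Qmx p alpha' beta' beta'
     /\ \sum_(i < 3) A i *m (A (res3 (i + 2)))^T = Qmx p alpha beta gamma).
Proof.
move=> _ R2 p_prime pE _ Q M alpha' beta' alpha beta gamma.
rewrite self_orthogonal_row_code tr_row_mx mul_row_col !block_circulant3_gram.
rewrite block_gramD block_gram_eq0 !addmx_eq0_pchar2 //.
have two0 : 2%:R = 0 :> R by apply/eqP; case/andP: R2.
(* The diagonal of S N becomes 1 in characteristic 2. *)
have odd1 : (2 * k + 1)%:R = 1 :> R by rewrite natrD natrM two0 mul0r add0r.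
have QE i j : Q i *m (Q j)^T = _ := mulQmx_tr p_prime pE _ _ _ _ _ _.
rewrite (eq_bigr _ (fun i _ => QE i i)).
rewrite (eq_bigr _ (fun i _ => QE i (res3 (i + 2)))) !Qmx_sum.
have alphaE f : \sum_(i < 3) (a i * a (f i)
    + (2 * k + 1)%:R * (b i * b (f i) + c i * c (f i)))
  = \sum_(i < 3) (a i * a (f i) + b i * b (f i) + c i * c (f i)).
  by apply: eq_bigr => i _; rewrite odd1; ring.
rewrite (alphaE id) (alphaE (fun i => res3 (i + 2))).
(* With equal parameters on both sides, the square and non-square values differ
   from beta' by the same term 2 k b_i c_i, which vanishes. *)
have betaE : \sum_(i < 3) (a i * c i + b i * a i + k%:R * b i * b i
    + k%:R * c i * c i + k%:R * b i * c i + (k + 1)%:R * c i * b i) = beta'.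
  apply: eq_bigr => i _.
  by rewrite -[RHS]addr0 -(mulr0 (k%:R * b i * c i)) -two0; ring.
have gammaE : \sum_(i < 3) (a i * b i + c i * a i + k%:R * b i * b i
    + k%:R * c i * c i + (k + 1)%:R * b i * c i + k%:R * c i * b i) = beta'.
  apply: eq_bigr => i _.
  by rewrite -[RHS]addr0 -(mulr0 (k%:R * b i * c i)) -two0; ring.
by rewrite betaE gammaE.
Qed.
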